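(* Let $A\in\mathbb{R}^{n\times n}$ be symmetric positive definite, and let $k$ be a fixed integer with $0<k<n$. Let $A_k^*\in\mathbb{R}^{k\times k}$ be a principal submatrix of $A$ that maximizes $\log\mathrm{vol}(B)$ among all principal submatrices $B\in\mathbb{R}^{k\times k}$ of $A$. Then the pivoted Cholesky selection algorithm is a greedy algorithm for maximizing the log-volume, that is, in each step $j=1,\ldots,k$ the selected index $t$ maximizes $\log\mathrm{vol}(A[\mathcal{S}_{j-1}\cup\{t\}])$ over all $t\in\{1,\ldots,n\}-\mathcal{S}_{j-1}$; and its output matrix $A_k\equiv A[\mathcal{S}_k]$ satisfies $$0\le\log\mathrm{vol}(A_k^* )-\log\mathrm{vol}(A_k)\le\left(1-\tfrac1k\right)^k\log\mathrm{vol}\bigl(A_k^*/\lambda_n(A)\bigr),$$ where $(1-\tfrac1k)^k\le\tfrac1e<.37$. Moreover, the upper bound is tight (holds with equality) for matrices $A$ that are non-zero multiples of the identity matrix.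
   Context: $\lambda_1(A)\ge\cdots\ge\lambda_n(A)$ are the eigenvalues of $A$. For $\mathcal{S}\subset\{1,\ldots,n\}$, $A[\mathcal{S}]$ is the principal submatrix of $A$ with rows and columns indexed by $\mathcal{S}$. For a nonsingular square matrix $B$, $\mathrm{vol}(B)=|\det(B)|$. Pivoted Cholesky selection. Input: symmetric positive semi-definite $A\in\mathbb{R}^{n\times n}$, integer $0<k\le\mathrm{rank}(A)$. Set $A_0=A$, $\mathcal{S}_0=\emptyset$, $\mathcal{T}_0=\{1,\ldots,n\}$. For $j=1,\ldots,k$: choose $t\in\mathcal{T}_{j-1}$ such that the diagonal element $a_{tt}$ of $A_{j-1}$ is the largest among the diagonal elements $a_{ii}$ of $A_{j-1}$ with $i\in\mathcal{T}_{j-1}$; with $a_t$ the $t$-th column of $A_{j-1}$, set $A_j=A_{j-1}-a_t a_{tt}^{-1}a_t^T$, $\mathcal{S}_j=\mathcal{S}_{j-1}\cup\{t\}$, $\mathcal{T}_j=\mathcal{T}_{j-1}-\{t\}$. Output: $A[\mathcal{S}_k]$. *)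

(* Defs.v *)
From mathcomp Require Import all_boot all_order all_algebra.
From mathcomp Require Import polyrcf.
From mathcomp Require Import reals sequences exp.

Set Implicit Arguments.
Unset Strict Implicit.
Unset Printing Implicit Defensive.

Import Order.TTheory GRing.Theory Num.Theory.

Local Open Scope ring_scope.

Section Eigenvalues.
Variables (R : rcfType) (n : nat).
Implicit Types A : 'M[R]_n.

(* [rootsR] lists the distinct real roots in increasing order; each root is
   repeated according to its multiplicity and the order is reversed.  For a
   non-symmetric matrix the non-real eigenvalues are not listed. *)
Definition eigenvalues A : seq R :=
  rev (flatten [seq nseq (mup x (char_poly A)) x | x <- rootsR (char_poly A)]).

(* Indexed from 1: [lambda A 1] is the largest and [lambda A n] the smallest
   eigenvalue of a symmetric [A]. *)
Definition lambda A (i : nat) : R := nth 0 (eigenvalues A) i.-1.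

Lemma mem_eigenvalues A x : (x \in eigenvalues A) = eigenvalue A x.
Proof.
have p0 : char_poly A != 0 by exact: monic_neq0 (char_poly_monic A).
rewrite mem_rev eigenvalue_root_char; apply/flatten_mapP/idP => [[y]|rx].
  by rewrite -roots_on_rootsR // => /andP[_ ry] /nseqP[-> _].
exists x; first by rewrite -roots_on_rootsR // in_itv.
by apply/nseqP; split; rewrite // -XsubC_dvd // dvdp_XsubCl.
Qed.

Lemma count_eigenvalues A x :
  count_mem x (eigenvalues A) = mup x (char_poly A).
Proof.
have p0 : char_poly A != 0 by exact: monic_neq0 (char_poly_monic A).
rewrite count_rev count_flatten -map_comp sumnE big_map.
under eq_bigr => y _ do rewrite /= count_nseq /=.
have [xr|xr] := boolP (x \in rootsR (char_poly A)).
  rewrite (bigD1_seq x) ?uniq_roots //= eqxx mul1n big1 ?addn0 // => y /negbTE.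
  by move=> ->.
rewrite big_seq big1 => [|y yr]; last first.
  by have [yx|//] := eqVneq y x; rewrite -yx yr in xr.
by rewrite mupNroot //; move: xr; rewrite -roots_on_rootsR // in_itv.
Qed.

Lemma sorted_eigenvalues A : sorted >=%R (eigenvalues A).
Proof.
rewrite rev_sorted /rootsR.
have := sorted_roots (- cauchy_bound (char_poly A))
  (cauchy_bound (char_poly A)) (char_poly A).
elim: (roots _ _ _) => //= y s IHs ys.
rewrite sorted_pairwise; last exact: le_trans.
rewrite pairwise_cat -!sorted_pairwise; try exact: le_trans.
rewrite IHs ?(path_sorted ys) // andbT; apply/andP; split.
  apply/allrelP => z1 z2 /nseqP[-> _] /flatten_mapP[z zs /nseqP[-> _]].
  by move: ys; rewrite lt_path_sortedE => /andP[/allP/(_ z zs)/ltW].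
elim: (mup _ _) => //= m; case: m => //= m ->; by rewrite lexx.
Qed.

(* In particular the list is the full spectrum as soon as the characteristic
   polynomial splits over [R]. *)
Lemma eigenvaluesE A (s : seq R) :
  char_poly A = \prod_(x <- s) ('X - x%:P) -> sorted >=%R s ->
  eigenvalues A = s.
Proof.
move=> As s_sorted; apply: (sorted_eq ge_trans ge_anti) => //.
  exact: sorted_eigenvalues.
by apply/allP => x _ /=; rewrite count_eigenvalues As mu_prod_XsubC.
Qed.

End Eigenvalues.

Section Cholesky.
Variables (R : realType) (n : nat).
Implicit Types A : 'M[R]_n.

Definition posdefmx A : Prop :=
  A \is symmetricmx /\
  forall x : 'cV[R]_n, x != 0 -> 0 < (x^T *m A *m x) 0 0.

Definition princ_submx A (S : {set 'I_n}) : 'M[R]_#|S| :=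
  mxsub (@enum_val _ (mem S)) (@enum_val _ (mem S)) A.

Definition vol m (B : 'M[R]_m) : R := `|\det B|.

(* Meant for nonsingular [B]: [ln 0 = 0] here. *)
Definition logvol m (B : 'M[R]_m) : R := ln (vol B).

Definition max_logvol A (k : nat) (S : {set 'I_n}) : Prop :=
  #|S| = k /\
  forall S' : {set 'I_n}, #|S'| = k ->
    logvol (princ_submx A S') <= logvol (princ_submx A S).

(* A run of [k] steps of pivoted Cholesky selection on [A].  The pivots are
   [t 1, ..., t k]; ties are broken arbitrarily.  The values of [As], [S], [T]
   beyond index [k], and of [t] outside 1..k, are irrelevant. *)
Record pivoted_cholesky A (k : nat) (As : nat -> 'M[R]_n)
    (S T : nat -> {set 'I_n}) (t : nat -> 'I_n) : Prop := PivotedCholesky {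
  pc_As0 : As 0%N = A;
  pc_S0 : S 0%N = set0;
  pc_T0 : T 0%N = [set: 'I_n];
  pc_pivot : forall j, (j < k)%N -> t j.+1 \in T j;
  pc_pivot_max : forall j, (j < k)%N ->
    forall i, i \in T j -> As j i i <= As j (t j.+1) (t j.+1);
  pc_AsS : forall j, (j < k)%N ->
    let a := col (t j.+1) (As j) in
    As j.+1 = As j - (As j (t j.+1) (t j.+1))^-1 *: (a *m a^T);
  pc_SS : forall j, (j < k)%N -> S j.+1 = t j.+1 |: S j;
  pc_TS : forall j, (j < k)%N -> T j.+1 = T j :\ t j.+1 }.

End Cholesky.

(* Main.v *)
Require Import Defs.
From mathcomp Require Import all_boot all_order all_algebra.
From mathcomp Require Import complex.
From mathcomp Require Import reals sequences exp.
From mathcomp Require Import ring lra.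

(** Two facts combine.

    Greedy selection of a submodular function.  Let [F] be a monotone function
    of finite sets with [F set0 = 0] and diminishing marginal gains, and let
    [S j] be built by always adding an element of largest gain.  A competitor
    [W] of size [k] can be reached from [S j] by adding at most [k] elements,
    none of which gains more than the greedy step does, so
    [F W - F (S j) <= k * (F (S j.+1) - F (S j))].  The distance to [F W] thus
    shrinks by the factor [1 - 1/k] at each step, and after [k] steps it is at
    most [(1 - 1/k)^k * F W]: this is [greedy_submodular_gap].

    Log-volumes of a positive definite matrix.  For [i] outside [S] the ratio
    of [\det A[i |: S]] to [\det A[S]] is the Schur complement of [A[S]] at
    [i], which is the minimum of the quadratic form [x^T A x] over the vectors
    [x] supported on [i |: S] with [x_i = 1] ([det_pad_submxU1],
    [schur_vec_form], [schur_vec_min]).  The minimum can only decrease when [S]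
    grows, so log-volume is submodular; and since such an [x] has norm at least
    one, the ratio is at least [lambda A n] by the Rayleigh bound
    [last_eigenvalue_rayleigh].  Dividing [A] by its smallest eigenvalue hence
    makes log-volume monotone, and [F S = logvol (A[S] / lambda A n)]
    satisfies all the hypotheses above.

    It remains to see that pivoted Cholesky is the greedy algorithm for [F]:
    each step is a column elimination, so the diagonal of the residual matrix
    consists of the Schur complements ([cholesky_residual]), and the largest
    diagonal entry is the largest gain ([cholesky_greedy]).  All sets compared
    at a given step have the same size, whence scaling by [lambda A n] does not
    affect the comparison.

    For a scalar matrix all principal submatrices of size [k] are equal, and
    [A / lambda A n] is the identity: both sides vanish. *)

Set Implicit Arguments.
Unset Strict Implicit.
Unset Printing Implicit Defensive.

Import Order.TTheory GRing.Theory Num.Theory.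

Local Open Scope ring_scope.

(** * Greedy maximization of submodular functions *)

Section Greedy.
Variables (R : realFieldType) (I : finType) (F : {set I} -> R).
Hypothesis F_mono : forall (S : {set I}) i, F S <= F (i |: S).
Hypothesis F_submod : forall (S S' : {set I}) i, S \subset S' -> i \notin S' ->
  F (i |: S') - F S' <= F (i |: S) - F S.

(** By diminishing gains, an element of [W] added on the way from [S] to
    [S :|: W] gains no more than it would have gained at [S]. *)
Lemma submodular_union_le (S W : {set I}) c :
  0 <= c -> (forall i, i \notin S -> F (i |: S) - F S <= c) ->
  F W <= F S + c *+ #|W|.
Proof.
move=> c0 Sc; apply: (@le_trans _ _ (F (S :|: W))).
  rewrite setUC; have [m] := ubnP #|S|.
  elim: m S {Sc} => // m IHm S; have [->|[i iS]] := set_0Vmem S.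
    by rewrite setU0.
  rewrite (cardsD1 i) iS ltnS => cS.
  apply: le_trans (IHm _ cS) _.
  by rewrite -[in leRHS](setD1K iS) setUCA F_mono.
have [m] := ubnP #|W|; elim: m W => // m IHm W.
have [->|[i iW]] := set_0Vmem W; first by rewrite setU0 cards0 mulr0n addr0.
rewrite (cardsD1 i W) iW ltnS mulrSr => cW; have := IHm _ cW.
rewrite -[S :|: W](_ : i |: (S :|: W :\ i) = _); last first.
  by rewrite setUCA setD1K.
set V := S :|: _; have [iV|iV] := boolP (i \in V).
  by rewrite (setUidPr _) ?sub1set//; lra.
have := @F_submod S V i (subsetUl _ _) iV.
have iS : i \notin S by apply: contra iV => iS; rewrite in_setU iS.
by have := Sc i iS; lra.
Qed.

(** The greedy gain is the constant [c] of [submodular_union_le], which turns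
    that bound into a contraction of the distance to [F Sstar]. *)
Lemma greedy_submodular_gap (k : nat) (Sstar : {set I})
    (S : nat -> {set I}) (t : nat -> I) :
  (0 < k)%N -> #|Sstar| = k -> F set0 = 0 -> S 0%N = set0 ->
  (forall j, (j < k)%N -> S j.+1 = t j.+1 |: S j) ->
  (forall j, (j < k)%N -> forall i, i \notin S j ->
     F (i |: S j) <= F (t j.+1 |: S j)) ->
  F Sstar - F (S k) <= (1 - k%:R^-1) ^+ k * F Sstar.
Proof.
move=> k0 cS F0 S0 SS tmax.
have kR : 0 < k%:R :> R by rewrite ltr0n.
have r0 : 0 <= 1 - k%:R^-1 :> R.
  by rewrite subr_ge0 invf_le1 // ler1n.
suff gap j : (j <= k)%N -> F Sstar - F (S j) <= (1 - k%:R^-1) ^+ j * F Sstar.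
  exact: gap.
elim: j => [|j IHj] jk; first by rewrite S0 F0 expr0 mul1r subr0.
rewrite exprS -mulrA; apply: le_trans (ler_wpM2l r0 (IHj (ltnW jk))).
have : F Sstar <= F (S j) + (F (S j.+1) - F (S j)) *+ k.
  rewrite -cS SS //; apply: submodular_union_le; first by rewrite subr_ge0.
  by move=> i iS; rewrite lerD2r tmax.
rewrite -[(_ - _) *+ k]mulr_natl => le_k.
rewrite -subr_ge0 -(pmulr_rge0 _ kR).
(* Multiplied by [k], the contraction inequality is exactly [le_k]. *)
set D := (X in 0 <= X).
suff -> : D = F (S j) + k%:R * (F (S j.+1) - F (S j)) - F Sstar.
  by rewrite subr_ge0.
by rewrite /D; field; rewrite gt_eqF.
Qed.

End Greedy.

(** * The spectrum of a symmetric real matrix *)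

Lemma char_poly_conj (F : fieldType) n (P D : 'M[F]_n) : P \in unitmx ->
  char_poly (invmx P *m D *m P) = char_poly D.
Proof.
move=> Pu; rewrite /char_poly /char_poly_mx.
pose cP := map_mx (@polyC F) P; pose cV := map_mx (@polyC F) (invmx P).
have VP : cV *m cP = 1%:M by rewrite -map_mxM mulVmx // map_mx1.
have -> : 'X%:M - map_mx polyC (invmx P *m D *m P) =
          cV *m ('X%:M - map_mx polyC D) *m cP.
  by rewrite !map_mxM mulmxBr mulmxBl mul_mx_scalar -scalemxAl VP scalemx1.
by rewrite !det_mulmx mulrC mulrA [_ * \det cV]mulrC -det_mulmx VP det1 mul1r.
Qed.

Section Spectrum.
Local Open Scope sesquilinear_scope.
Variables (R : rcfType) (n : nat) (A : 'M[R]_n).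
Hypothesis A_sym : A \is symmetricmx.
Local Notation toC := (map_mx (real_complex R)).

(** A real symmetric matrix is hermitian over [R[i]], so it is unitarily
    diagonalizable there, with eigenvalues that are real. *)
Lemma symmetric_spectral :
  exists (P : 'M[R[i]]_n) (d : 'rV[R]_n),
    P \is unitarymx /\ toC A = P^t* *m diag_mx (toC d) *m P.
Proof.
pose B := toC A.
have Bh : B \is hermsymmx.
  apply: realsym_hermsym.
    have /is_hermitianmxP := A_sym; rewrite expr0 scale1r map_mx_id // => AT.
    apply/is_hermitianmxP; rewrite expr0 scale1r map_mx_id //.
    by rewrite /B {1}AT map_trmx.
  by apply/mxOverP => i j; rewrite mxE complex_real.
have dR := hermitian_spectral_diag_real Bh.
have := hermitian_normalmx Bh => /orthomx_spectralP BE.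
exists (spectralmx B), (map_mx (@complex.Re R) (spectral_diag B)).
split; first exact: spectral_unitarymx.
rewrite [LHS]BE invmx_unitary ?spectral_unitarymx //.
congr (_ *m diag_mx _ *m _); apply/rowP => j; rewrite !mxE.
by rewrite RRe_real //; apply: (mxOverP dR).
Qed.

(** The characteristic polynomial splits over [R], so [eigenvalues] is the
    whole spectrum with multiplicities; in particular it has length [n]. *)
Lemma symmetric_eigenvalues_diag (P : 'M[R[i]]_n) (d : 'rV[R]_n) :
  P \is unitarymx -> toC A = P^t* *m diag_mx (toC d) *m P ->
  eigenvalues A = sort >=%R [seq d 0 i | i <- enum 'I_n].
Proof.
move=> Pu AE; apply: eigenvaluesE; last exact: (sort_sorted (@ge_total _ R)).
rewrite (perm_big [seq d 0 i | i <- enum 'I_n]) ?perm_sort //=.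
rewrite big_map big_enum /=.
apply: (map_poly_inj (real_complex R)).
rewrite map_char_poly AE -invmx_unitary // char_poly_conj ?unitarymx_unit //.
rewrite char_poly_trig ?diag_mx_is_trig // rmorph_prod; apply: eq_bigr => i _.
by rewrite rmorphB /= map_polyX map_polyC /= !mxE eqxx mulr1n.
Qed.

Lemma last_eigenvalue_le (d : 'rV[R]_n) i :
  eigenvalues A = sort >=%R [seq d 0 i | i <- enum 'I_n] ->
  lambda A n <= d 0 i.
Proof.
move=> eA; have sz : size (eigenvalues A) = n.
  by rewrite eA size_sort size_map size_enum_ord.
have : d 0 i \in eigenvalues A by rewrite eA mem_sort map_f ?mem_enum.
case/(nthP 0) => m; rewrite sz => mn <-.
have /(sorted_leq_nth ge_trans ge_refl) := sorted_eigenvalues A.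
by apply; rewrite ?inE ?sz //; case: n mn => //.
Qed.

(** In the coordinates [y] of [x] in a unitary eigenbasis, the two forms are
    the sum of the [d_i |y_i|^2] and that of the [|y_i|^2]. *)
Lemma last_eigenvalue_rayleigh (x : 'cV[R]_n) :
  lambda A n * (x^T *m x) 0 0 <= (x^T *m A *m x) 0 0.
Proof.
have [P [d [Pu AE]]] := symmetric_spectral.
have lmin i := last_eigenvalue_le i (symmetric_eigenvalues_diag Pu AE).
pose y := P *m toC x.
have xtC : (toC x)^t* = toC x^T.
  by apply/matrixP => i j; rewrite !mxE; apply: conjc_real.
have yt : y^t* = toC x^T *m P^t* by rewrite /y trmx_mul map_mxM -xtC.
have yA : ((x^T *m A *m x) 0 0)%:C%C = \sum_i (d 0 i)%:C%C * `|y i 0| ^+ 2.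
  have -> : ((x^T *m A *m x) 0 0)%:C%C = (y^t* *m diag_mx (toC d) *m y) 0 0.
    rewrite yt /y !mulmxA -!(mulmxA (toC x^T)) -AE -!map_mxM.
    by rewrite [RHS]mxE !mulmxA.
  rewrite mul_mx_diag [LHS]mxE; apply: eq_bigr => i _; rewrite !mxE.
  by rewrite normCK mulrAC mulrC; congr (_ * _); apply: mulrC.
have yy : ((x^T *m x) 0 0)%:C%C = \sum_i `|y i 0| ^+ 2.
  have -> : ((x^T *m x) 0 0)%:C%C = (y^t* *m y) 0 0.
    rewrite yt /y -invmx_unitary // mulmxA mulmxKV ?unitarymx_unit //.
    by rewrite -map_mxM [RHS]mxE.
  by rewrite [LHS]mxE; apply: eq_bigr => i _; rewrite normCK mulrC !mxE.
rewrite -lecR rmorphM /= yA yy mulr_sumr; apply: ler_sum => i _.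
by rewrite ler_wpM2r ?exprn_ge0 // lecR.
Qed.

Lemma last_eigenvalue_is_eigenvalue : (0 < n)%N -> eigenvalue A (lambda A n).
Proof.
move=> n0; have [P [d [Pu AE]]] := symmetric_spectral.
rewrite -mem_eigenvalues mem_nth // (symmetric_eigenvalues_diag Pu AE).
by rewrite size_sort size_map size_enum_ord; case: n n0.
Qed.
End Spectrum.

Lemma posdef_last_eigenvalue_gt0 (R : realType) n (A : 'M[R]_n) :
  posdefmx A -> (0 < n)%N -> 0 < lambda A n.
Proof.
case=> A_sym A_pos n0.
have /eigenvalueP[v vA v0] := last_eigenvalue_is_eigenvalue A_sym n0.
have /A_pos : v^T != 0 by rewrite trmx_eq0.
rewrite trmxK vA -scalemxAl mxE => vv.
have v2 : 0 <= (v *m v^T) 0 0.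
  by rewrite mxE sumr_ge0 // => i _; rewrite mxE -expr2 sqr_ge0.
by apply: contraTT vv; rewrite -!leNgt => ?; rewrite mulr_le0_ge0.
Qed.

(** * Determinants of principal submatrices *)

(** Sylvester's identity: both sides are the determinant of the block matrix
    with rows [(1, -B)] and [(C, 1)], eliminated from either diagonal block. *)
Lemma det_1Dmul_comm (R : comNzRingType) (m n : nat) (B : 'M[R]_(m, n))
    (C : 'M[R]_(n, m)) :
  \det (1%:M + B *m C) = \det (1%:M + C *m B).
Proof.
have := congr1 determinant (mulmx_block 1%:M B 0 1%:M 1%:M (- B) C 1%:M).
rewrite det_mulmx det_ublock !det1 !mul1r !mul1mx !mul0mx !mulmx1 !add0r addNr.
rewrite det_lblock det1 mulr1 => <-.
have := congr1 determinant (mulmx_block 1%:M 0 (- C) 1%:M 1%:M (- B) C 1%:M).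
rewrite det_mulmx det_lblock !det1 !mul1r !mul1mx !mul0mx !mulmx1 !addr0 addNr.
by rewrite det_ublock det1 mul1r mulNmx mulmxN opprK addrC => ->; rewrite addrC.
Qed.

Section Pad.
Variables (R : comNzRingType) (n : nat).
Implicit Types (A : 'M[R]_n) (S : {set 'I_n}) (x : 'cV[R]_n).

(** Completing [A[S]] by rows of the identity gives a matrix with the same
    determinant ([det_princ_submx]) and a size that does not depend on [S], so
    that these determinants can be compared for different sets. *)
Definition pad_submx S A : 'M[R]_n :=
  \matrix_(i, j) if i \in S then A i j else (i == j)%:R.

(** Block elimination of the unknowns in [S]: [A *m x] vanishes on [S], and its
    entry at [i] is then the Schur complement of [A[S]] at [i]. *)
Definition schur_vec A S (i : 'I_n) x : Prop :=
  [/\ x i 0 = 1, (forall j, j \notin i |: S -> x j 0 = 0)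
    & forall s, s \in S -> (A *m x) s 0 = 0].

Lemma pad_submx_mulE S A x s :
  (pad_submx S A *m x) s 0 = if s \in S then (A *m x) s 0 else x s 0.
Proof.
rewrite mxE; case: ifP => sS.
  by rewrite mxE; apply: eq_bigr => j _; rewrite mxE sS.
rewrite (bigD1 s) //= mxE sS eqxx mul1r big1 ?addr0 // => j js.
by rewrite mxE sS eq_sym (negbTE js) mul0r.
Qed.

Lemma det_pad_submx0 A : \det (pad_submx set0 A) = 1.
Proof.
by rewrite -(det1 R n); congr determinant; apply/matrixP => i j; rewrite !mxE inE.
Qed.

(** Replacing column [i] of the padded matrix by the image of [x] under it is a
    unimodular operation, as [x i 0 = 1], and leaves in that column at most one
    nonzero entry, the one at [i]. *)
Lemma det_pad_submxU1 A S i x : i \notin S -> schur_vec A S i x ->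
  \det (pad_submx (i |: S) A) = (A *m x) i 0 * \det (pad_submx S A).
Proof.
move=> iS [xi x0 Ax0].
pose X : 'M[R]_n := \matrix_(j, l) if l == i then x j 0 else (j == l)%:R.
have X1 : \det X = 1.
  rewrite (expand_det_row X i) (bigD1 i) //= big1 => [|j ji]; last first.
    by rewrite mxE (negbTE ji) eq_sym (negbTE ji) mul0r.
  rewrite mxE eqxx xi mul1r addr0 /cofactor addnn -signr_odd odd_double mul1r.
  rewrite -[RHS](det1 R n.-1); congr determinant; apply/matrixP => j l.
  by rewrite !mxE eq_sym (negbTE (neq_lift _ _)) (inj_eq lift_inj).
pose M := pad_submx (i |: S) A *m X.
have colM j l : l != i -> M j l = pad_submx (i |: S) A j l.
  move=> li; rewrite mxE (bigD1 l) //= big1 => [|m ml].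
    by rewrite addr0 [X in _ * X]mxE (negbTE li) eqxx mulr1.
  by rewrite [X in _ * X]mxE (negbTE li) (negbTE ml) mulr0.
have colMi j : M j i = (A *m x) i 0 *+ (j == i).
  transitivity ((pad_submx (i |: S) A *m x) j 0).
    by rewrite !mxE; apply: eq_bigr => m _; rewrite [X in _ * X]mxE eqxx.
  rewrite pad_submx_mulE in_setU1; have [->|ji] /= := eqVneq j i; first by [].
  case: ifP => jS; first exact: Ax0.
  by rewrite x0 // in_setU1 negb_or ji jS.
(* Expanding the left side along column [i] and the right side along row [i]
   produces the same minor: the two matrices differ only in this row and this
   column. *)
rewrite -[LHS]mulr1 -X1 -det_mulmx -/M (expand_det_col M i) (bigD1 i) //=.
rewrite big1 => [|j ji]; last by rewrite colMi (negbTE ji) mul0r.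
rewrite colMi eqxx addr0; congr (_ * _).
rewrite (expand_det_row _ i) (bigD1 i) //= [pad_submx _ _ _ _]mxE (negbTE iS) eqxx.
rewrite mul1r big1 => [|j ji]; last first.
  by rewrite mxE (negbTE iS) eq_sym (negbTE ji) mul0r.
rewrite addr0; congr (_ * \det _); apply/matrixP => j l; rewrite 2!mxE.
rewrite colM ?(eq_sym _ i) ?neq_lift // !mxE in_setU1 [_ == i]eq_sym.
by rewrite (negbTE (neq_lift _ _)).
Qed.

End Pad.

(** With [E] the inclusion of the coordinates in [S], the two matrices are
    [1 + E (A - 1) E^T] and [1 + E^T E (A - 1)]. *)
Lemma det_princ_submx (R : realType) n (A : 'M[R]_n) (S : {set 'I_n}) :
  \det (princ_submx A S) = \det (pad_submx S A).
Proof.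
pose E : 'M[R]_(#|S|, n) := rowsub (@enum_val _ (mem S)) 1%:M.
have EE : E *m E^T = 1%:M.
  apply/matrixP => a b; rewrite mxE (bigD1 (enum_val a)) //= big1 => [|j ja].
    by rewrite !mxE eqxx mul1r addr0 eq_sym (inj_eq enum_val_inj).
  by rewrite !mxE eq_sym (negbTE ja) mul0r.
have TE : E^T *m E = \matrix_(i, j) ((i == j) && (i \in S))%:R.
  apply/matrixP => i j; rewrite !mxE; have [iS|iS] := boolP (i \in S).
    rewrite (bigD1 (enum_rank_in iS i)) //= big1 => [|a ai].
      by rewrite !mxE enum_rankK_in // eqxx mul1r addr0 andbT.
    rewrite !mxE (_ : enum_val a == i = false) ?mul0r //.
    apply: contraNF ai => /eqP ai; apply/eqP/enum_val_inj.
    by rewrite enum_rankK_in.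
  rewrite andbF big1 // => a _; rewrite !mxE (_ : _ == i = false) ?mul0r //.
  by apply: contraNF iS => /eqP <-; apply: enum_valP.
have -> : princ_submx A S = 1%:M + (E *m (A - 1%:M)) *m E^T.
  rewrite mulmxBr mulmxBl mulmx1 EE addrC subrK.
  rewrite mul_rowsub_mx mul1mx; apply/matrixP => a b.
  rewrite [LHS]mxE [RHS]mxE (bigD1 (enum_val b)) //= big1 => [|j jb].
    by rewrite !mxE eqxx mulr1 addr0.
  by rewrite !mxE eq_sym (negbTE jb) mulr0.
rewrite det_1Dmul_comm mulmxA TE; congr determinant; apply/matrixP => i j.
rewrite !mxE (bigD1 i) //= big1 => [|l li]; last first.
  by rewrite mxE eq_sym (negbTE li) mul0r.
rewrite !mxE eqxx addr0 /=; case: (i \in S).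
  by rewrite mul1r addrC subrK.
by rewrite mul0r addr0.
Qed.

(** * Schur complements of a positive definite matrix *)

Section PosDef.
Variables (R : realType) (n : nat) (A : 'M[R]_n).
Hypothesis A_pd : posdefmx A.
Implicit Types (S : {set 'I_n}) (x y : 'cV[R]_n).
Local Notation pad S := (pad_submx S A).
Local Notation schur := (schur_vec A).

Lemma posdef_tr : A^T = A.
Proof.
by case: A_pd => /is_hermitianmxP; rewrite expr0 scale1r map_mx_id // => <-.
Qed.

Lemma schur_vec_form S i x y : schur S i x ->
  y i 0 = 1 -> (forall j, j \notin i |: S -> y j 0 = 0) ->
  (y^T *m A *m x) 0 0 = (A *m x) i 0.
Proof.
move=> [_ _ Ax0] yi y0; rewrite -mulmxA mxE (bigD1 i) //= big1 => [|j ji].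
  by rewrite mxE yi mul1r addr0.
rewrite mxE; have [jS|jS] := boolP (j \in S); first by rewrite Ax0 ?mulr0.
by rewrite y0 ?mul0r // in_setU1 negb_or ji.
Qed.

(** Since [y - x] is supported on [S], where [A *m x] vanishes, it is
    [A]-orthogonal to [x], and the form at [y] splits as in Pythagoras. *)
Lemma schur_vec_min S i x y : schur S i x ->
  y i 0 = 1 -> (forall j, j \notin i |: S -> y j 0 = 0) ->
  (A *m x) i 0 <= (y^T *m A *m y) 0 0.
Proof.
move=> sx yi y0; have [xi x0 _] := sx.
have yx := schur_vec_form sx yi y0.
have xx := schur_vec_form sx xi x0.
have xy : (x^T *m A *m y) 0 0 = (A *m x) i 0.
  rewrite -yx -[in LHS](trmxK (x^T *m A *m y)) mxE.
  by rewrite !trmx_mul trmxK posdef_tr mulmxA.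
have : 0 <= ((y - x)^T *m A *m (y - x)) 0 0.
  have [->|/(proj2 A_pd)/ltW//] := eqVneq (y - x) 0.
  by rewrite mulmx0 mxE.
rewrite [(y - x)^T]linearB /= !mulmxBl !mulmxBr.
have mxB (B C : 'M[R]_1) : (B - C) 0 0 = B 0 0 - C 0 0 by rewrite !mxE.
by rewrite !mxB xx xy yx; lra.
Qed.

Lemma schur_vec_gt0 S i x : schur S i x -> 0 < (A *m x) i 0.
Proof.
move=> sx; have [xi x0 _] := sx.
rewrite -(schur_vec_form sx xi x0); apply: (proj2 A_pd).
by apply: contra_eq_neq xi => ->; rewrite mxE eq_sym oner_eq0.
Qed.

(** The padded matrix is invertible, since a vector [v] of its kernel is
    supported on [S] with [A *m v] zero on [S], so that [v^T A v = 0].  The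
    entries of the Schur vector on [S] then solve a linear system. *)
Lemma schur_vec_exists S i : i \notin S -> exists x, schur S i x.
Proof.
move=> iS.
have padU : pad S \in unitmx.
  rewrite -unitmx_tr -row_free_unit -kermx_eq0; apply/rowV0P => v /sub_kermxP.
  move=> /(congr1 trmx); rewrite trmx_mul trmxK trmx0 => Pv0.
  have [->//|v0] := eqVneq v 0.
  have /(proj2 A_pd) : v^T != 0 by rewrite trmx_eq0.
  rewrite -mulmxA mxE big1 ?ltxx // => j _.
  have : (if j \in S then (A *m v^T) j 0 else v^T j 0) = 0.
    by rewrite -pad_submx_mulE Pv0 mxE.
  by rewrite [X in X * _]mxE; case: ifP => _ ->; rewrite ?mulr0 ?mul0r.
pose e : 'cV[R]_n := delta_mx i 0.
pose b : 'cV[R]_n := \col_s if s \in S then - (A *m e) s 0 else 0.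
pose u := invmx (pad S) *m b.
have ub s : (if s \in S then (A *m u) s 0 else u s 0) = b s 0.
  by rewrite -pad_submx_mulE /u mulKVmx.
exists (e + u); split=> [|j|s sS].
- by have := ub i; rewrite (negbTE iS) !mxE (negbTE iS) !eqxx => ->; rewrite addr0.
- rewrite in_setU1 negb_or => /andP[ji jS]; have := ub j.
  rewrite (negbTE jS) [b _ _]mxE (negbTE jS) !mxE (negbTE ji) => ->.
  by rewrite addr0.
have := ub s; rewrite sS [b _ _]mxE sS => us.
by rewrite mulmxDr [LHS]mxE us subrr.
Qed.

Lemma det_pad_submx_gt0 S : 0 < \det (pad S).
Proof.
have [m] := ubnP #|S|; elim: m S => // m IHm S.
have [->|[i iS]] := set_0Vmem S; first by rewrite det_pad_submx0.
rewrite (cardsD1 i) iS ltnS => /IHm S0.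
have iS' : i \notin S :\ i by rewrite setD11.
have [x sx] := schur_vec_exists iS'.
by rewrite -(setD1K iS) (det_pad_submxU1 iS' sx) mulr_gt0 // (schur_vec_gt0 sx).
Qed.

Lemma logvol_princ S : logvol (princ_submx A S) = ln (\det (pad S)).
Proof. by rewrite /logvol /vol det_princ_submx gtr0_norm ?det_pad_submx_gt0. Qed.

Lemma logvol_princU1 S i x : i \notin S -> schur S i x ->
  logvol (princ_submx A (i |: S)) = ln ((A *m x) i 0) + logvol (princ_submx A S).
Proof.
move=> iS sx; rewrite !logvol_princ (det_pad_submxU1 iS sx) lnM //.
  by rewrite posrE (schur_vec_gt0 sx).
by rewrite posrE det_pad_submx_gt0.
Qed.

End PosDef.

(** * Log-volume relative to the smallest eigenvalue *)

Section ScaledLogVolume.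
Variables (R : realType) (n : nat) (A : 'M[R]_n).
Hypotheses (A_pd : posdefmx A) (n_gt0 : (0 < n)%N).
Implicit Types S : {set 'I_n}.

(** This is the log-volume of [A[S] / lambda A n] ([scaled_logvolE]), written so
    that the marginal gains can be read off. *)
Definition scaled_logvol S : R :=
  logvol (princ_submx A S) - ln (lambda A n) *+ #|S|.

Lemma scaled_logvolE S :
  scaled_logvol S = logvol ((lambda A n)^-1 *: princ_submx A S).
Proof.
have l0 := posdef_last_eigenvalue_gt0 A_pd n_gt0.
rewrite /scaled_logvol /logvol /vol detZ normrM det_princ_submx.
have d0 := det_pad_submx_gt0 A_pd S.
rewrite !gtr0_norm ?exprn_gt0 ?invr_gt0 // lnM ?posrE ?exprn_gt0 ?invr_gt0 //.
by rewrite lnXn ?invr_gt0 // lnV ?posrE // mulNrn addrC.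
Qed.

Lemma scaled_logvol0 : scaled_logvol set0 = 0.
Proof.
by rewrite /scaled_logvol logvol_princ // det_pad_submx0 ln1 cards0 subrr.
Qed.

Lemma scaled_logvol_gain S i x : i \notin S -> schur_vec A S i x ->
  scaled_logvol (i |: S) - scaled_logvol S
    = ln ((A *m x) i 0) - ln (lambda A n).
Proof.
move=> iS sx; rewrite /scaled_logvol (logvol_princU1 A_pd iS sx).
by rewrite cardsU1 iS mulrS; ring.
Qed.

(** A Schur complement of [A] is a value of the quadratic form at a vector of
    norm at least one, hence at least the smallest eigenvalue. *)
Lemma scaled_logvol_mono S i : scaled_logvol S <= scaled_logvol (i |: S).
Proof.
have [iS|iS] := boolP (i \in S); first by rewrite (setUidPr _) ?sub1set.
have [x sx] := schur_vec_exists A_pd iS; have [xi x0 _] := sx.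
have l0 := posdef_last_eigenvalue_gt0 A_pd n_gt0.
rewrite -subr_ge0 (scaled_logvol_gain iS sx) subr_ge0.
rewrite ler_ln ?posrE ?(schur_vec_gt0 A_pd sx) //.
rewrite -(schur_vec_form sx xi x0).
apply: le_trans (last_eigenvalue_rayleigh (proj1 A_pd) x).
rewrite ler_peMr ?(ltW l0) // mxE (bigD1 i) //= mxE xi mulr1 lerDl.
by rewrite sumr_ge0 // => j _; rewrite mxE -expr2 sqr_ge0.
Qed.

(** The Schur vector of [S] competes in the minimization that defines the Schur
    complement at the larger set [S']. *)
Lemma scaled_logvol_submod S S' i : S \subset S' -> i \notin S' ->
  scaled_logvol (i |: S') - scaled_logvol S' <=
    scaled_logvol (i |: S) - scaled_logvol S.
Proof.
move=> SS' iS'; have iS : i \notin S by apply: contra iS'; apply/subsetP.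
have [x sx] := schur_vec_exists A_pd iS; have [xi x0 _] := sx.
have [x' sx'] := schur_vec_exists A_pd iS'.
rewrite (scaled_logvol_gain iS sx) (scaled_logvol_gain iS' sx') lerD2r.
rewrite ler_ln ?posrE ?(schur_vec_gt0 A_pd sx) ?(schur_vec_gt0 A_pd sx') //.
rewrite -(schur_vec_form sx xi x0); apply: (schur_vec_min A_pd sx') => // j jS'.
by apply: x0; apply: contra jS'; apply/subsetP; rewrite setUS.
Qed.

End ScaledLogVolume.

(** * Pivoted Cholesky is the greedy algorithm *)

Section PivotedCholesky.
Variables (R : realType) (n k : nat) (A : 'M[R]_n).
Variables (As : nat -> 'M[R]_n) (S T : nat -> {set 'I_n}) (t : nat -> 'I_n).
Hypothesis run : pivoted_cholesky A k As S T t.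

Lemma cholesky_candidates j : (j <= k)%N -> T j = ~: S j.
Proof.
elim: j => [|j IHj] jk; first by rewrite (pc_S0 run) (pc_T0 run) setC0.
by rewrite (pc_TS run) // (pc_SS run) // IHj 1?ltnW // setCU setIC setDE.
Qed.

Lemma cholesky_pivot_notin j : (j < k)%N -> t j.+1 \notin S j.
Proof.
by move=> jk; rewrite -in_setC -cholesky_candidates ?(ltnW jk) // (pc_pivot run).
Qed.

Lemma cholesky_card j : (j <= k)%N -> #|S j| = j.
Proof.
elim: j => [|j IHj] jk; first by rewrite (pc_S0 run) cards0.
by rewrite (pc_SS run) // cardsU1 cholesky_pivot_notin // IHj // ltnW.
Qed.

(** The residual matrix is obtained from [A] by column operations that use only
    pivot columns, so its remaining columns are images by [A] of Schur vectors;
    its diagonal entries there are the Schur complements, which are positive, so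
    no step divides by zero. *)
Lemma cholesky_residual : posdefmx A -> forall j, (j <= k)%N ->
  [/\ (As j)^T = As j, forall s i, s \in S j -> As j s i = 0
    & forall i, i \notin S j ->
        exists2 x, schur_vec A (S j) i x & A *m x = col i (As j)].
Proof.
move=> A_pd; elim=> [|j IHj] jk.
  rewrite (pc_As0 run) (pc_S0 run); split=> [|s i|i _].
  - exact: posdef_tr.
  - by rewrite inE.
  exists (delta_mx i 0); last by rewrite -colE.
  split=> [|j|s]; rewrite ?inE // mxE ?eqxx //.
  by rewrite orbF => /negbTE ->.
have [AsT As0 Asx] := IHj (ltnW jk).
have tS := cholesky_pivot_notin jk.
have AsC a b : As j a b = As j b a by rewrite -[in LHS]AsT mxE.
have [xt sxt Axt] := Asx _ tS.
have att : 0 < As j (t j.+1) (t j.+1).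
  by have := schur_vec_gt0 A_pd sxt; rewrite Axt mxE.
have AsE a b : As j.+1 a b = As j a b
    - As j a (t j.+1) * As j b (t j.+1) / As j (t j.+1) (t j.+1).
  by rewrite (pc_AsS run) // !mxE big_ord1 !mxE [_^-1 * _]mulrC.
have As0' s i : s \in S j.+1 -> As j.+1 s i = 0.
  rewrite (pc_SS run) // in_setU1 AsE => /orP[/eqP->|sS].
    by rewrite (AsC _ i) mulrAC mulfV ?gt_eqF // mul1r subrr.
  by rewrite !(As0 s) // !mul0r subr0.
split=> // [|i].
  by apply/matrixP => a b; rewrite mxE !AsE AsC [X in X / _]mulrC.
rewrite {1}(pc_SS run) // in_setU1 negb_or => /andP[it iS].
have [x sx Ax] := Asx _ iS.
have [xi x0 _] := sx; have [xti xt0 _] := sxt.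
(* One step subtracts from column [i] the multiple of the pivot column that
   clears its entry in the pivot row. *)
pose x' := x - (As j i (t j.+1) / As j (t j.+1) (t j.+1)) *: xt.
have Ax' : A *m x' = col i (As j.+1).
  rewrite mulmxBr -scalemxAr Ax Axt; apply/colP => a.
  by rewrite !mxE AsE; ring.
exists x' => //; split=> [|l|s sS].
- by rewrite !mxE xi xt0 ?mulr0 ?subr0 // in_setU1 negb_or it.
- rewrite (pc_SS run) // !in_setU1 !negb_or => /and3P[li lt lS].
  by rewrite !mxE x0 ?xt0 ?mulr0 ?subr0 // in_setU1 negb_or ?li ?lt.
by rewrite Ax' mxE As0'.
Qed.

Lemma cholesky_greedy : posdefmx A -> forall j, (j < k)%N ->
  forall i, i \notin S j ->
    logvol (princ_submx A (i |: S j)) <= logvol (princ_submx A (t j.+1 |: S j)).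
Proof.
move=> A_pd j jk i iS; have tS := cholesky_pivot_notin jk.
have [_ _ Asx] := cholesky_residual A_pd (ltnW jk).
have [[x sx Ax] [xt sxt Axt]] := (Asx _ iS, Asx _ tS).
rewrite (logvol_princU1 A_pd iS sx) (logvol_princU1 A_pd tS sxt) lerD2r.
rewrite ler_ln ?posrE ?(schur_vec_gt0 A_pd sx) ?(schur_vec_gt0 A_pd sxt) //.
rewrite Ax Axt !mxE (pc_pivot_max run) //.
by rewrite cholesky_candidates ?(ltnW jk) // in_setC.
Qed.

End PivotedCholesky.

(** * Scalar matrices *)

Lemma eigenvalues_scalar (R : rcfType) n (c : R) :
  eigenvalues (c%:M : 'M[R]_n) = nseq n c.
Proof.
apply: eigenvaluesE; last first.
  by elim: n => // -[|n] //= ->; rewrite lexx.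
rewrite char_poly_trig ?scalar_mx_is_trig // big_nseq.
rewrite (eq_bigr (fun=> 'X - c%:P)) => [|i _]; last by rewrite mxE eqxx.
by rewrite big_const card_ord.
Qed.

Lemma princ_submx_scalar (R : realType) n (c : R) (S : {set 'I_n}) :
  princ_submx c%:M S = c%:M.
Proof. by apply/matrixP => a b; rewrite !mxE (inj_eq enum_val_inj). Qed.

(** * The constant 1/e *)

(** The partial sum [1 + 1 + 1/2 + 1/6 + 1/24] of the exponential series is
    [65/24], which already exceeds [100/37]. *)
Lemma exp1_gt (R : realType) : 100 / 37 < expR 1 :> R.
Proof.
apply: (@lt_le_trans _ _ (series (exp_coeff 1) 5%N : R)).
  rewrite /series /= !big_nat_recr //= big_geq // /exp_coeff /= !expr1n /=.
  by rewrite !factS fact0; lra.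
apply: (nondecreasing_cvgn_le _ (is_cvg_series_exp_coeff _)).
by apply: nondecreasing_series => i _ _; apply: exp_coeff_ge0.
Qed.

Lemma expR1V_lt (R : realType) : (expR 1 : R)^-1 < 37 / 100.
Proof.
rewrite -[ltRHS]invrK invf_div ltf_pV2 ?exp1_gt // posrE ?expR_gt0 //.
by rewrite divr_gt0 ?ltr0n.
Qed.

(** The [k]-th power of [1 - 1/k <= exp (- 1/k)]. *)
Lemma pow_1BV_le (R : realType) k : (0 < k)%N ->
  (1 - (k%:R : R)^-1) ^+ k <= (expR 1)^-1.
Proof.
move=> k0; have kR : 0 < k%:R :> R by rewrite ltr0n.
have -> : (expR 1)^-1 = expR (- (k%:R : R)^-1) ^+ k.
  by rewrite -expRM_natl mulrN mulfV ?gt_eqF// expRN.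
rewrite lerXn2r ?nnegrE ?expR_ge0 ?expR_ge1Dx//.
by rewrite subr_ge0 invf_le1 // ler1n.
Qed.

(** * The performance guarantee *)

Theorem theorem6p2 (R : realType) (n k : nat) (hk : (0 < k < n)%N) :
  (forall (A : 'M[R]_n) (Sstar : {set 'I_n}) (As : nat -> 'M[R]_n)
          (S T : nat -> {set 'I_n}) (t : nat -> 'I_n),
      posdefmx A ->
      max_logvol A k Sstar ->
      pivoted_cholesky A k As S T t ->
      (forall j : nat, (j < k)%N ->
         t j.+1 \notin S j /\
         forall i : 'I_n, i \notin S j ->
           logvol (princ_submx A (i |: S j)) <=
           logvol (princ_submx A (t j.+1 |: S j))) /\
      0 <= logvol (princ_submx A Sstar) - logvol (princ_submx A (S k)) /\
      logvol (princ_submx A Sstar) - logvol (princ_submx A (S k)) <=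
        (1 - k%:R^-1) ^+ k *
        logvol ((lambda A n)^-1 *: princ_submx A Sstar)) /\
  ((1 - (k%:R : R)^-1) ^+ k <= (expR 1)^-1 /\
   (expR 1 : R)^-1 < 37%:R / 100%:R) /\
  (forall (c : R) (Sstar : {set 'I_n}) (As : nat -> 'M[R]_n)
          (S T : nat -> {set 'I_n}) (t : nat -> 'I_n),
      c != 0 ->
      max_logvol (c%:M) k Sstar ->
      pivoted_cholesky (c%:M) k As S T t ->
      logvol (princ_submx c%:M Sstar) - logvol (princ_submx c%:M (S k)) =
        (1 - k%:R^-1) ^+ k *
        logvol ((lambda (c%:M : 'M[R]_n) n)^-1 *: princ_submx c%:M Sstar)).
Proof.
have /andP[k0 kn] := hk; have n0 := ltn_trans k0 kn.
split=> [A Sstar As S T t A_pd [cSstar Smax] run|].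
  split=> [j jk|].
    split; first exact: (cholesky_pivot_notin run).
    exact: (cholesky_greedy run A_pd jk).
  have cS := cholesky_card run (leqnn k).
  split; first by rewrite subr_ge0 Smax.
  rewrite -scaled_logvolE //.
  have gain_eq j i : (j < k)%N -> i \notin S j ->
      scaled_logvol A (i |: S j)
        = logvol (princ_submx A (i |: S j)) - ln (lambda A n) *+ j.+1.
    move=> jk iS; rewrite /scaled_logvol; congr (_ - _ *+ _).
    by rewrite cardsU1 iS (cholesky_card run) ?(ltnW jk).
  have -> : logvol (princ_submx A Sstar) - logvol (princ_submx A (S k))
      = scaled_logvol A Sstar - scaled_logvol A (S k).
    rewrite /scaled_logvol; move: (logvol _) (logvol _) => a b.
    by rewrite cSstar cS; ring.
  have gap := greedy_submodular_gap (scaled_logvol_mono A_pd n0)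
    (scaled_logvol_submod A_pd) k0 cSstar (scaled_logvol0 A_pd)
    (pc_S0 run) (pc_SS run).
  apply: gap => j jk i iS.
  rewrite !gain_eq ?(cholesky_pivot_notin run) // lerD2r.
  exact: (cholesky_greedy run).
split; first by split; [exact: pow_1BV_le | exact: expR1V_lt].
move=> c Sstar As S T t c0 [cSstar _] run.
have -> : lambda (c%:M : 'M[R]_n) n = c.
  by rewrite /lambda eigenvalues_scalar nth_nseq prednK // leqnn.
rewrite !princ_submx_scalar scale_scalar_mx mulVf // /logvol /vol !det_scalar.
by rewrite cSstar (cholesky_card run) // subrr expr1n normr1 ln1 mulr0.
Qed.
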